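(* Let $n=2^k$ with $k\ge 3$ an integer, and let $D$ be a set of proper divisors of $n$ with $1\notin D$. Then the circulant graph $C_n\cup G(n,D)$ and its complement both admit pretty good state transfer with respect to the same sequence in $2\pi\mathbb{Z}$; that is, there is a sequence $\{t_m\}$ of elements of $2\pi\mathbb{Z}$ such that both $C_n\cup G(n,D)$ and its complement admit pretty good state transfer with respect to $\{t_m\}$.
   Context: For a finite simple graph $G$ with adjacency matrix $A$, the transition matrix is $H(t)=\exp(-itA)$, $t\in\mathbb{R}$. For a vertex $u$, $e_u$ denotes the standard basis (column) vector indexed by $u$. The graph $G$ admits pretty good state transfer with respect to a sequence of real numbers $\{t_m\}$ if there exist two distinct vertices $u,v$ and a complex number $\gamma$ with $|\gamma|=1$ such that $\lim_{m\to\infty}H(t_m)e_u=\gamma e_v$. The cycle $C_n$ is the graph with vertex set $\mathbb{Z}_n$ in which $a,b$ are adjacent if and only if $a-b\in\{1,n-1\}$. A proper divisor of $n$ is a positive divisor $d<n$. For a proper divisor $d$ of $n$, let $S_n(d)=\{x\in\mathbb{Z}_n:\gcd(x,n)=d\}$, and for a (possibly empty) set $D$ of proper divisors of $n$ let $S_n(D)=\bigcup_{d\in D}S_n(d)$. The gcd graph $G(n,D)$ is the graph with vertex set $\mathbb{Z}_n$ in which $a,b$ are adjacent if and only if $a-b\in S_n(D)$. The graph $C_n\cup G(n,D)$ has vertex set $\mathbb{Z}_n$ and edge set the union of the edge sets of $C_n$ and $G(n,D)$ (which are disjoint when $1\notin D$). *)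

(* Defs.v *)
From HB Require Import structures.
From mathcomp Require Import all_boot all_order all_algebra.
From mathcomp Require Import finmap complex.
From mathcomp Require Import all_classical all_reals all_analysis.

Set Implicit Arguments.
Unset Strict Implicit.
Unset Printing Implicit Defensive.

Import Order.TTheory GRing.Theory Num.Theory numFieldNormedType.Exports.

Local Open Scope classical_set_scope.
Local Open Scope complex_scope.
Local Open Scope ring_scope.

(* MathComp-Analysis gives abstract number fields their norm topology, but the
   concrete type R[i] has none; it receives here the topology of its modulus,
   and its matrices inherit the entrywise one. *)
HB.instance Definition _ (R : rcfType) := NormedModule.copy R[i] (R[i])^o.

Record sgraph (n : nat) := SGraph {
  adj :> rel 'I_n;
  adj_sym : symmetric adj;
  adj_irrefl : irreflexive adj }.

Section GraphOperations.
Variable n : nat.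
Implicit Types G H : sgraph n.

Definition compl_adj G : rel 'I_n := fun a b => (a != b) && ~~ G a b.

Lemma compl_adj_sym G : symmetric (compl_adj G).
Proof. by move=> a b; rewrite /compl_adj eq_sym adj_sym. Qed.

Lemma compl_adj_irrefl G : irreflexive (compl_adj G).
Proof. by move=> a; rewrite /compl_adj eqxx. Qed.

Definition compl_graph G := SGraph (compl_adj_sym G) (compl_adj_irrefl G).

Definition union_adj G H : rel 'I_n := fun a b => G a b || H a b.

Lemma union_adj_sym G H : symmetric (union_adj G H).
Proof. by move=> a b; rewrite /union_adj adj_sym [H a b]adj_sym. Qed.

Lemma union_adj_irrefl G H : irreflexive (union_adj G H).
Proof. by move=> a; rewrite /union_adj !adj_irrefl. Qed.

Definition union_graph G H :=
  SGraph (union_adj_sym G H) (union_adj_irrefl G H).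

End GraphOperations.

(* 'Z_n is 'I_(Zp_trunc n).+2, and 'I_n when 1 < n. *)
Section CirculantGraphs.
Variable n : nat.

(* In 'Z_n, the residue n - 1 is -1. *)
Definition cycle_adj : rel 'Z_n := fun a b => (a - b == 1) || (a - b == - 1).

Lemma cycle_adj_sym : symmetric cycle_adj.
Proof.
by move=> a b; rewrite /cycle_adj -(opprB a b) !eqr_oppLR opprK orbC.
Qed.

Lemma cycle_adj_irrefl : irreflexive cycle_adj.
Proof.
by move=> a; rewrite /cycle_adj subrr eq_sym oner_eq0 eq_sym oppr_eq0 oner_eq0.
Qed.

Definition cycle_graph : sgraph (Zp_trunc n).+2 :=
  SGraph cycle_adj_sym cycle_adj_irrefl.

Definition proper_divisors (D : {fset nat}) : Prop :=
  forall d, d \in D -> (d %| n)%N /\ (d < n)%N.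

Definition gcd_class (d : nat) : {set 'Z_n} := [set x : 'Z_n | gcdn x n == d]%SET.

Definition gcd_set (D : {fset nat}) : {set 'Z_n} :=
  (\bigcup_(d <- D) gcd_class d)%SET.

Definition gcd_adj (D : {fset nat}) : rel 'Z_n := fun a b => a - b \in gcd_set D.

Lemma in_gcd_set (D : {fset nat}) (x : 'Z_n) :
  (x \in gcd_set D) = (gcdn x n \in D).
Proof.
rewrite /gcd_set (big_morph (fun A : {set 'Z_n} => x \in A)
  (fun A B => finset.in_setU x A B) (finset.in_set0 x)) big_has.
apply/hasP/idP => [[d dD]|xD]; first by rewrite inE => /eqP ->.
by exists (gcdn x n) => //; rewrite inE.
Qed.

Lemma proper_divisors_gt1 (D : {fset nat}) (d : nat) :
  proper_divisors D -> d \in D -> (1 < n)%N.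
Proof.
move=> hD /hD [dn dlt]; case: n dn dlt => [|[|m]] //.
by rewrite dvdn1 => /eqP ->.
Qed.

Lemma gcd_adj_sym (D : {fset nat}) : proper_divisors D -> symmetric (gcd_adj D).
Proof.
move=> hD.
have hN (x : 'Z_n) : x \in gcd_set D -> - x \in gcd_set D.
  rewrite !in_gcd_set => xD; have n1 := proper_divisors_gt1 hD xD.
  suff -> : gcdn (- x)%R n = gcdn x n by [].
  have xn : (x <= n)%N by rewrite -[leqRHS](Zp_cast n1) ltnW.
  rewrite /=; move: (nat_of_ord x) xn => y yn; rewrite !(Zp_cast n1) gcdn_modl.
  rewrite -[X in gcdn _ X](subnK yn).
  by rewrite gcdnDl gcdnC -[in RHS](subnKC yn) gcdnDl.
by move=> a b; apply/idP/idP => /hN; rewrite opprB.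
Qed.

Lemma gcd_adj_irrefl (D : {fset nat}) :
  proper_divisors D -> irreflexive (gcd_adj D).
Proof.
move=> hD a; rewrite /gcd_adj subrr in_gcd_set gcd0n; apply/negP => /hD [_].
by rewrite ltnn.
Qed.

Definition gcd_graph (D : {fset nat}) (hD : proper_divisors D) :
    sgraph (Zp_trunc n).+2 :=
  SGraph (gcd_adj_sym hD) (gcd_adj_irrefl hD).

End CirculantGraphs.

Section StateTransfer.
Variable R : realType.

Definition expmx (n : nat) (X : 'M[R[i]]_n) : 'M[R[i]]_n :=
  lim (series (fun j : nat => (j`!%:R)^-1 *: X ^+ j) @ \oo).

Definition adjmx (n : nat) (G : sgraph n) : 'M[R[i]]_n :=
  \matrix_(a, b) (G a b)%:R.

Definition transition_mx (n : nat) (G : sgraph n) (t : R) : 'M[R[i]]_n :=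
  expmx (- ('i * t%:C) *: adjmx G).

Definition basis_vec (n : nat) (u : 'I_n) : 'cV[R[i]]_n := delta_mx u 0.

Definition pretty_good_state_transfer (n : nat) (G : sgraph n) (t : nat -> R) :
    Prop :=
  exists u v : 'I_n, u != v /\
    exists gamma : R[i], `|gamma| = 1 /\
      (fun m => transition_mx G (t m) *m basis_vec u) @ \oo
        --> gamma *: basis_vec v.

End StateTransfer.

(* Main.v *)
(** A time in [2 pi Z] kills every integer eigenvalue.  The eigenvalues of
    [C_n U G(n,D)] are [2 cos (2 pi j / n)] plus the Ramanujan sums of the gcd
    classes, which are integers, and complementing changes the sign up to
    integers.  So at such times the transition matrix of the graph is that of
    [C_n], that of its complement is the complex conjugate, and it suffices to
    send vertex 0 to vertex [n/2] on [C_n], i.e. to find [z] in [N] for which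
    [exp (- 2 pi i z 2 cos (2 pi j / n))] is simultaneously close to [(-1)^j].

    Let [w_j] denote that exponential at [z = 1].  The mean over [z] of
    [|sum_j (-1)^j w_j^z|^(2p)] counts the pairs of [p]-tuples [f], [g] with the
    same product of [w]'s, provided those have the same sign; there are at least
    [n^(2p)] of them up to a factor polynomial in [p], so the sum comes
    arbitrarily close to [n] in modulus, hence all its terms to the term [1] of
    [j = 0].  The signs agree unless an integer relation
    [sum_f theta_j - sum_g theta_j \in Z] between the [theta_j = zeta^j + zeta^-j]
    has sides of different parity.  Such a relation is an integer polynomial
    divisible by [X^(n/2) + 1], and since [4 | n/2] the coefficients of such a
    polynomial at exponents congruent to 1 mod 4 have an even sum; for odd [j]
    exactly one of [j], [n - j] is congruent to 1 mod 4, for even [j] none is. *)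
Require Import Defs.
From mathcomp Require Import all_boot all_order all_algebra all_field.
From mathcomp Require Import finmap complex.
From mathcomp Require Import all_classical all_reals all_analysis.
From mathcomp Require Import ring lra zify.

Set Implicit Arguments.
Unset Strict Implicit.
Unset Printing Implicit Defensive.

Import Order.TTheory GRing.Theory Num.Theory numFieldNormedType.Exports.

Local Open Scope classical_set_scope.
Local Open Scope complex_scope.
Local Open Scope ring_scope.

(** * Simultaneous approximation *)

Section SimultaneousApproximation.
Variable R : realType.
Local Notation C := R[i].

(** As [x ^+ p = expR (p%:R * ln x)], its Taylor term of degree s + 1 alone outgrows [(2p)^s], which
    bounds [(p+1)^s] for p > 0. *)
Lemma expr_gt_poly (x : R) (s : nat) :
  1 < x -> exists p : nat, (p.+1 ^ s)%:R < x ^+ p.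
Proof.
move=> x1; have lx : 0 < ln x by rewrite ln_gt0.
have x0 : 0 < x by apply: lt_trans x1.
pose a := ln x ^+ s.+1 / s.+1`!%:R.
have a0 : 0 < a by rewrite divr_gt0 ?exprn_gt0 // ltr0n fact_gt0.
have [p pP] : exists p : nat, 2 ^+ s / a < p%:R.
  by exists (Num.Def.archi_bound (2 ^+ s / a)); apply/archi_boundP/divr_ge0/ltW => //; apply: exprn_ge0.
exists p.
have p0 : (0 < p)%N.
  by rewrite -(ltr0n R); apply: le_lt_trans pP; apply/divr_ge0/ltW => //; apply: exprn_ge0.
have -> : x ^+ p = expR (p%:R * ln x).
  by rewrite expRM_natl lnK.
apply: lt_le_trans (expR_ge1Dxn s _); last by rewrite mulr_ge0 // ltW.
apply: (@le_lt_trans _ _ (2 ^+ s * p%:R ^+ s)).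
  rewrite -exprMn natrX lerXn2r ?nnegrE ?mulr_ge0 // -natrM ler_nat; lia.
apply: (@lt_le_trans _ _ (p%:R ^+ s.+1 * a)).
  rewrite exprS mulrAC mulrC [ltRHS]mulrC ltr_pM2l ?exprn_gt0 ?ltr0n //.
  by rewrite -ltr_pdivrMr.
by rewrite /a exprMn mulrA lerDr ler01.
Qed.

(** The order of [R[i]] is partial and comparable numbers have equal imaginary parts: M = 0 makes
    [B] real, M = 1 then makes [D] real, and the real parts are Archimedean. *)
Lemma complex_archi_le0 (D B : C) :
  (forall M : nat, M%:R * D <= B) -> D <= 0.
Proof.
move=> H.
have := H 0%N; rewrite mul0r lecE /= => /andP[/eqP iB _].
have := H 1%N; rewrite mul1r lecE iB eq_sym => /andP[iD _].
rewrite lecE /= eq_sym iD /= leNgt; apply/negP => rD.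
have rB : complex.Re B / complex.Re D < (Num.Def.archi_bound (complex.Re B / complex.Re D))%:R.
  apply/archi_boundP/divr_ge0/ltW => //.
  by have := H 0%N; rewrite mul0r lecE => /andP[].
have := H (Num.Def.archi_bound (complex.Re B / complex.Re D)).
rewrite lecE => /andP[_].
rewrite mulr_natl raddfMn /= -mulr_natl leNgt -ltr_pdivrMr //.
by rewrite rB.
Qed.

Lemma geometric_sum_bound (q : C) (M : nat) :
  `|q| = 1 -> q != 1 -> `|\sum_(z < M) q ^+ z| <= 2 / `|q - 1|.
Proof.
move=> nq q1; rewrite ler_pdivlMr ?normr_gt0 ?subr_eq0 // -normrM mulrC.
rewrite -subrX1; apply: le_trans (ler_normB _ _) _.
by rewrite normrX nq expr1n normr1.
Qed.

(** Frequencies [q t = 1] contribute exactly M times [a t]; each other one gives a geometric sum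
    bounded independently of M. *)
Lemma trig_mean_bound (T : finType) (a q : T -> C) :
  (forall t, `|q t| = 1) ->
  exists B, forall M : nat,
    `|\sum_(z < M) \sum_t a t * q t ^+ z - M%:R * \sum_(t | q t == 1) a t| <= B.
Proof.
move=> nq; exists (\sum_(t | q t != 1) `|a t| * (2 / `|q t - 1|)) => M.
rewrite exchange_big /= (bigID (fun t => q t == 1)) /=.
rewrite [X in `|X + _ - _|](_ : _ = M%:R * \sum_(t | q t == 1) a t); last first.
  rewrite mulr_sumr; apply: eq_bigr => t /eqP ->.
  under eq_bigr do rewrite expr1n mulr1.
  by rewrite sumr_const card_ord mulr_natl.
rewrite addrAC subrr add0r; apply: le_trans (ler_norm_sum _ _ _) _.
apply: ler_sum => t qt; rewrite -mulr_sumr normrM.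
by apply: ler_wpM2l => //; apply: geometric_sum_bound.
Qed.

(** * Bohr's mean value proof of Kronecker's theorem *)

Section Bohr.
Variables (I : finType) (w c : I -> C).
Hypothesis nw : forall i, `|w i| = 1.
Hypothesis nc : forall i, `|c i| = 1.
Hypothesis wc : forall (p : nat) (f g : {ffun 'I_p -> I}),
  \prod_k w (f k) = \prod_k w (g k) -> \prod_k c (f k) = \prod_k c (g k).

Local Notation F z := (\sum_i (c i)^-1 * w i ^+ z).

Lemma norm1_invE (x : C) : `|x| = 1 -> x^-1 = x^*.
Proof. by move=> nx; rewrite invC_norm nx expr1n invr1 mul1r. Qed.

(* Tuples with the same multiplicities have the same product, so the most
   populated multiplicity class already gives this many collisions. *)
Lemma sum_collisions p :
  (#|I| ^ (p * 2) <=
   #|[set fg : {ffun 'I_p -> I} * {ffun 'I_p -> I} |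
       (\prod_k w (fg.1 k) == \prod_k w (fg.2 k))%R]%SET| * p.+1 ^ (#|I| * 2))%N.
Proof.
set S := [set fg | _]%SET.
pose cnt (f : {ffun 'I_p -> I}) : {ffun I -> 'I_p.+1} :=
  [ffun i => inord #|[set k | f k == i]%SET|].
have cntE f i : cnt f i = #|[set k | f k == i]%SET| :> nat.
  rewrite ffunE inordK // ltnS -[leqRHS]card_ord; exact: max_card.
have prodE (f : {ffun 'I_p -> I}) : \prod_k w (f k) = \prod_i w i ^+ cnt f i.
  rewrite (partition_big f xpredT) //=; apply: eq_bigr => i _.
  rewrite cntE -prodr_const; apply: eq_big => [k|k /eqP -> //].
  by rewrite inE.
pose fib k := [set f | cnt f == k]%SET.
have sumE : (\sum_k #|fib k| = #|I| ^ p)%N.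
  rewrite -[in RHS](card_ord p) -card_ffun -sum1_card.
  rewrite (partition_big cnt xpredT) //=; apply: eq_bigr => k _.
  by rewrite -sum1_card; apply: eq_bigl => f; rewrite !inE.
have [k0 hk0] : exists k, (#|I| ^ p <= #|fib k| * p.+1 ^ #|I|)%N.
  have [|k0 hk0] := @bigop.eq_bigmax {ffun I -> 'I_p.+1} (fun k => #|fib k|).
    by rewrite card_ffun card_ord expn_gt0.
  exists k0; rewrite -hk0 -sumE.
  apply: (@leq_trans (\sum_(k : {ffun I -> 'I_p.+1}) \max_k #|fib k|)).
    by apply: leq_sum => k _; apply: leq_bigmax.
  by rewrite sum_nat_const card_ffun card_ord mulnC.
have fibS : (#|fib k0| * #|fib k0| <= #|S|)%N.
  rewrite -cardsX; apply: subset_leq_card; apply/fintype.subsetP => -[f g].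
  by rewrite !inE /= => /andP[/eqP ef /eqP eg]; rewrite !prodE ef eg.
rewrite !expnM -!mulnn; apply: leq_trans (leq_mul hk0 hk0) _.
by rewrite mulnACA leq_mul.
Qed.

(** On the unit circle conjugation is inversion, so this product is a trigonometric sum in [z],
    ready for [trig_mean_bound]. *)
Lemma sum_power_expand p z :
  F z ^+ p * (F z ^+ p)^* =
  \sum_(fg : {ffun 'I_p -> I} * {ffun 'I_p -> I})
    (\prod_k c (fg.1 k))^-1 * \prod_k c (fg.2 k) *
    (\prod_k w (fg.1 k) * (\prod_k w (fg.2 k))^-1) ^+ z.
Proof.
have E : F z ^+ p = \sum_(f : {ffun 'I_p -> I})
    (\prod_k c (f k))^-1 * (\prod_k w (f k)) ^+ z.
  rewrite -[in LHS](card_ord p) -prodr_const bigA_distr_bigA /=.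
  by apply: eq_bigr => f _; rewrite big_split /= prodfV prodrXl.
rewrite E rmorph_sum /= big_distrlr /= pair_big /=.
apply: eq_bigr => -[f g] _ /=; rewrite exprMn exprVn.
have nP (u : I -> C) (h : {ffun 'I_p -> I}) : (forall i, `|u i| = 1) ->
    `|\prod_k u (h k)| = 1.
  by move=> nu; rewrite normr_prod big1.
rewrite rmorphM rmorphXn /= -!norm1_invE ?nP // ?normfV ?nP ?invr1 //.
rewrite invrK exprVn; ring.
Qed.

(** If [r] bounded all the moduli, the mean of their 2p-th powers would be at most [r^(2p)], while
    collisions make it at least [|I|^(2p) / (p+1)^(2|I|)]: absurd for some p. *)
Lemma norm_power_sum_near_max (r : R) :
  r < #|I|%:R -> exists z : nat, r%:C < `|F z|.
Proof.
move=> rI.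
have [r0|r0] := ltP r 0.
  by exists 0%N; apply: lt_le_trans (normr_ge0 _); rewrite ltcR.
apply/not_existsP => H.
have {}H z : `|F z| <= r%:C.
  rewrite real_leNgt ?normr_real //; first exact/negP/H.
  by rewrite realE lecR r0.
have key p : (#|I| ^ (p * 2))%:R <= (r ^+ (p * 2)) * (p.+1 ^ (#|I| * 2))%:R.
  apply: le_trans (_ : #|[set fg : {ffun 'I_p -> I} * {ffun 'I_p -> I} |
       (\prod_k w (fg.1 k) == \prod_k w (fg.2 k))%R]%SET|%:R *
       (p.+1 ^ (#|I| * 2))%:R <= _).
    by rewrite -natrM ler_nat sum_collisions.
  apply: ler_wpM2r => //.
  pose q (fg : {ffun 'I_p -> I} * {ffun 'I_p -> I}) :=
    \prod_k w (fg.1 k) * (\prod_k w (fg.2 k))^-1.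
  pose a (fg : {ffun 'I_p -> I} * {ffun 'I_p -> I}) :=
    (\prod_k c (fg.1 k))^-1 * \prod_k c (fg.2 k).
  have nq t : `|q t| = 1.
    by rewrite normrM normfV !normr_prod !big1 // invr1 mulr1.
  (* the time average of [|F z| ^ 2p] counts the collisions *)
  have [B HB] := trig_mean_bound a nq.
  have p0 (u : I -> C) (h : {ffun 'I_p -> I}) : (forall i, `|u i| = 1) ->
    \prod_k u (h k) != 0.
    by move=> nu; apply/prodf_neq0 => i _; rewrite -normr_gt0 nu.
  (* By [wc] every collision has coefficient 1. *)
  have sa : \sum_(t | q t == 1) a t = #|[set fg : {ffun 'I_p -> I} * {ffun 'I_p -> I} |
       (\prod_k w (fg.1 k) == \prod_k w (fg.2 k))%R]%SET|%:R.
    rewrite -sum1_card natr_sum; apply: eq_big => [[f g]|[f g]].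
      by rewrite inE /q /= -(inj_eq (mulIf (p0 w g nw))) mulfVK ?p0 // mul1r.
    rewrite /q /a /= => /eqP /(congr1 (fun x => x * \prod_k w (g k))).
    by rewrite mulfVK ?p0 // mul1r => /wc ->; rewrite mulVf ?p0.
  set K := #|_| in sa *.
  rewrite -subr_le0 -lecR rmorphB /=.
  apply: (@complex_archi_le0 _ B) => M.
  have := HB M; rewrite sa; apply: le_trans.
  apply: (@le_trans _ _ (M%:R * K%:R - \sum_(z < M) `|F z ^+ p| ^+ 2)).
    rewrite rmorph_nat mulrBr lerD2l lerN2.
    apply: le_trans (_ : \sum_(z < M) (r ^+ (p * 2))%:C <= _).
      by apply: ler_sum => z _; rewrite normrX -exprM rmorphXn /= lerXn2r ?nnegrE // lecR.
    by rewrite sumr_const card_ord mulr_natl.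
  under eq_bigr do rewrite normCK sum_power_expand.
  rewrite distrC; apply: real_ler_norm; apply: rpredB.
    by rewrite -natrM realn.
  apply: sum_real => z _; rewrite -sum_power_expand -normCK.
  by apply: rpredX; apply: normr_real.
have I0 : (0 < #|I|)%N by rewrite -(ltr0n R); apply: le_lt_trans rI.
have [r00|r00] := eqVneq r 0.
  by have := key 1%N; rewrite r00 expr0n mul0r lern0 expn_eq0 eqn0Ngt I0.
have r1 : 1 < #|I|%:R / r :> R by rewrite ltr_pdivlMr ?mul1r // lt0r r00.
have [p] := expr_gt_poly #|I| r1.
(* Squaring produces the exponents [p * 2] and [#|I| * 2] of [key]. *)
apply/negP; rewrite -leNgt -(@ler_pXn2r R 2) ?nnegrE ?exprn_ge0 ?divr_ge0 //.
rewrite -exprM expr_div_n ler_pdivrMr ?exprn_gt0 ?lt0r ?r00 //.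
by have := key p; rewrite -!natrX -!expnM mulrC.
Qed.

End Bohr.

(** The other |I| - 2 terms add at most |I| - 2, so [|1 + x i| >= 2 - d]; the parallelogram law
    turns this into a bound on [|x i - 1|]. *)
Lemma unit_sum_close (I : finType) (x : I -> C) (i0 i : I) (d : C) :
  (forall j, `|x j| = 1) -> x i0 = 1 -> #|I|%:R - d <= `|\sum_j x j| ->
  0 <= d -> `|x i - 1| ^+ 2 <= 4 * d.
Proof.
move=> nx x0 dx d0; have [->|ii0] := eqVneq i i0.
  by rewrite x0 subrr normr0 expr0n mulr_ge0.
have y2 : 2 - d <= `|1 + x i|.
  rewrite (bigD1 i0) //= (bigD1 i) //= x0 addrA in dx.
  have cI : (#|I| = #|[pred j | (j != i0) && (j != i)]| + 2)%N.
    rewrite -sum1_card (bigD1 i0) //= (bigD1 i) //= sum1_card addnA addnC.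
    by congr (_ + _)%N; apply: eq_card => j; rewrite !inE.
  have rest : `|\sum_(j | (j != i0) && (j != i)) x j| <=
      #|[pred j | (j != i0) && (j != i)]|%:R.
    apply: le_trans (ler_norm_sum _ _ _) _.
    by under eq_bigr do rewrite nx; rewrite sumr_const.
  have := le_trans dx (le_trans (ler_normD _ _) (lerD (lexx _) rest)).
  by rewrite cI natrD -addrA addrC lerD2r.
have par : `|x i - 1| ^+ 2 = 4 - `|1 + x i| ^+ 2.
  have xx : x i * (x i)^* = 1 by rewrite -normCK nx expr1n.
  rewrite !normCK rmorphB rmorphD /= rmorph1; ring: xx.
(* The tangent to the square at 2 replaces squaring [2 - d], which may be negative. *)
have y4 : 4 * `|1 + x i| - 4 <= `|1 + x i| ^+ 2.
  rewrite -subr_ge0.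
  have -> : `|1 + x i| ^+ 2 - (4 * `|1 + x i| - 4) = (`|1 + x i| - 2) ^+ 2 by ring.
  by rewrite real_exprn_even_ge0 // rpredB ?normr_real // realn.
rewrite par -subr_ge0.
have -> : 4 * d - (4 - `|1 + x i| ^+ 2) =
    `|1 + x i| ^+ 2 - (4 * `|1 + x i| - 4) + 4 * (`|1 + x i| - (2 - d)) by ring.
by rewrite addr_ge0 ?mulr_ge0 ?subr_ge0.
Qed.

Lemma kronecker_approx (I : finType) (w c : I -> C) (i0 : I) (e : R) :
  (forall i, `|w i| = 1) -> (forall i, `|c i| = 1) ->
  (forall (p : nat) (f g : {ffun 'I_p -> I}),
     \prod_k w (f k) = \prod_k w (g k) -> \prod_k c (f k) = \prod_k c (g k)) ->
  w i0 = 1 -> c i0 = 1 -> 0 < e ->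
  exists z : nat, forall i, `|w i ^+ z - c i| < e%:C.
Proof.
(* This makes the bound [4 * d] of [unit_sum_close] equal to half of [e ^+ 2]. *)
move=> nw nc wc w0 c0 e0; pose d := e ^+ 2 / 8.
have dlt : 0 < d by rewrite divr_gt0 ?exprn_gt0.
have [z zP] : exists z : nat, (#|I|%:R - d)%:C < `|\sum_i (c i)^-1 * w i ^+ z|.
  by apply: norm_power_sum_near_max => //; rewrite ltrBlDr ltrDl.
exists z => i; have cn0 j : c j != 0 by rewrite -normr_gt0 nc.
have -> : `|w i ^+ z - c i| = `|(c i)^-1 * w i ^+ z - 1|.
  rewrite -[RHS]mul1r -[X in X * _](nc i) -normrM.
  by rewrite [in RHS]mulrBr mulr1 mulrA divff ?mul1r.
have := @unit_sum_close I (fun i => (c i)^-1 * w i ^+ z) i0 i d%:C.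
rewrite /= => H; rewrite -(@ltr_pXn2r _ 2) ?nnegrE //; last by rewrite lecR ltW.
apply: le_lt_trans (H _ _ _ _) _.
- by move=> j; rewrite normrM normfV normrX nw nc expr1n invr1 mulr1.
- by rewrite w0 c0 expr1n invr1 mulr1.
- by rewrite ltW // -[X in X - _](rmorph_nat (@real_complex R)) -rmorphB.
- by rewrite lecR ltW.
rewrite -[4](rmorph_nat (@real_complex R)) -rmorphM -rmorphXn ltcR /= /d.
have : 0 < e ^+ 2 by rewrite exprn_gt0.
lra.
Qed.
End SimultaneousApproximation.

(** * Integer relations between roots of unity of 2-power order *)

Lemma primitive_root_pow2 (F : numFieldType) (x : F) (r : nat) :
  x ^+ (2 ^ r) = -1 -> (2 ^ r.+1).-primitive_root x.
Proof.
move=> xr; have x1 : x ^+ (2 ^ r.+1) = 1.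
  by rewrite expnSr exprM xr sqrrN expr1n.
have [d dx] := prim_order_exists (expn_gt0 2 r.+1) x1.
move=> /(dvdn_pfactor _ _ (isT : prime 2)) [e]; rewrite leq_eqVlt => /predU1P[->|er] de.
  by rewrite -de.
have /eqP : x ^+ (2 ^ r) = 1.
  by apply/eqP; rewrite -(prim_order_dvd dx) de dvdn_exp2l.
by rewrite xr eq_sym -subr_eq0 opprK (_ : 1 + 1 = 2%:R) // pnatr_eq0.
Qed.

Section IntegerPolynomials.
Variables (F : numFieldType) (r : nat) (x : F).
Hypothesis xr : x ^+ (2 ^ r) = -1.
Local Notation h := (2 ^ r)%N.

(** A gcd over the rationals moves the common root of [p] and [X^h + 1] from [F] to [algC], where
    its minimal polynomial is cyclotomic of degree [h]. *)
Lemma size_int_poly_root_pow2 (p : {poly int}) :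
  p != 0 -> root (map_poly intr p) x -> (h < size p)%N.
Proof.
move=> p0 px.
pose pQ : {poly rat} := map_poly intr p.
have spQ : size pQ = size p.
  by rewrite size_map_inj_poly // => ? ? /eqP; rewrite eqr_int => /eqP.
pose G := gcdp pQ ('X^h + 1).
(* A Bezout identity would fail at [x], where both polynomials vanish. *)
have G1 : size G != 1%N.
  apply/negP => /Bezout_eq1_coprimepP[[u v] /= uv].
  have /(congr1 (fun s => (map_poly (ratr : rat -> F) s).[x])) := uv.
  rewrite rmorphD !rmorphM rmorphD rmorph1 /= map_polyXn !hornerE xr.
  rewrite addNr mulr0 addr0 -map_poly_comp (eq_map_poly (g := intr)); last first.
    by move=> z /=; rewrite ratr_int.
  by rewrite (rootP px) mulr0 rmorph1 hornerE => /eqP; rewrite eq_sym oner_eq0.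
have [|w wG] := closed_rootP (map_poly (ratr : rat -> algC) G) _.
  by rewrite size_map_poly.
have wr : w ^+ h = -1.
  have := dvdp_gcdr pQ ('X^h + 1); rewrite -/G => /dvdpP[s].
  move/(congr1 (fun s => (map_poly (ratr : rat -> algC) s).[w])).
  rewrite rmorphD rmorphM rmorph1 /= map_polyXn !hornerE (rootP wG).
  by rewrite mulr0 => /eqP; rewrite addr_eq0 => /eqP.
have [m [wm mm mP]] := minCpolyP w.
have mG : m %| pQ.
  apply: dvdp_trans (dvdp_gcdl pQ ('X^h + 1)).
  by rewrite -mP.
have pQ0 : pQ != 0 by rewrite -size_poly_eq0 spQ size_poly_eq0.
rewrite -spQ; apply: leq_trans (dvdp_leq pQ0 mG).
rewrite -(size_map_poly (ratr : rat -> algC)) -wm.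
have wprim := primitive_root_pow2 wr.
rewrite (minCpoly_cyclotomic wprim) -(Cintr_Cyclotomic wprim).
rewrite size_map_inj_poly ?size_Cyclotomic; last 2 first.
- by move=> ? ? /eqP; rewrite eqr_int => /eqP.
- by [].
by rewrite totient_pfactor // mul1n.
Qed.

(** The divisor is monic, so division stays over the integers; the remainder also vanishes at [x]
    and is too short to be nonzero. *)
Lemma dvdp_int_poly_root_pow2 (p : {poly int}) :
  root (map_poly intr p) x -> exists q, p = q * ('X^h + 1).
Proof.
move=> px.
have mon : 'X^h + 1 \is @monic int by rewrite -[1]opprK -polyCN monicXnsubC ?expn_gt0.
exists (Pdiv.Ring.rdivp p ('X^h + 1)).
have E := Pdiv.RingMonic.rdivp_eq mon p.
rewrite [LHS]E; set m := Pdiv.Ring.rmodp _ _ in E *.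
suff -> : m = 0 by rewrite addr0.
apply/eqP/negPn/negP => /size_int_poly_root_pow2 H.
have /H : root (map_poly intr m) x.
  move: px; rewrite {1}E rmorphD rmorphM rmorphD rmorph1 /= map_polyXn.
  by rewrite /root !hornerE xr addNr mulr0 add0r.
apply/negP; rewrite -leqNgt -ltnS.
have -> : h.+1 = size ('X^h + 1 : {poly int}).
  by rewrite -[1]opprK -polyCN size_XnsubC ?expn_gt0.
by rewrite Pdiv.Ring.ltn_rmodp monic_neq0.
Qed.

End IntegerPolynomials.

(** Values in ['F_2] turn parities into equalities and make signs immaterial. *)
Definition sum_coef_1mod4 (p : {poly int}) : 'F_2 :=
  \sum_(i < size p | (i %% 4 == 1)%N) (p`_i)%:~R.

Lemma sum_coef_1mod4E (p : {poly int}) N : (size p <= N)%N ->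
  sum_coef_1mod4 p = \sum_(i < N | (i %% 4 == 1)%N) (p`_i)%:~R.
Proof.
move=> pN; rewrite /sum_coef_1mod4 (big_ord_widen_cond N (fun i => i %% 4 == 1)%N (fun i => (p`_i)%:~R)) //.
rewrite big_mkcondr; apply: eq_bigr => i _; case: ltnP => // pi.
by rewrite nth_default.
Qed.

Lemma sum_coef_1mod4D p q : sum_coef_1mod4 (p + q) = sum_coef_1mod4 p + sum_coef_1mod4 q.
Proof.
rewrite (sum_coef_1mod4E (size_polyD p q)).
rewrite (sum_coef_1mod4E (leq_maxl (size p) (size q))).
rewrite (sum_coef_1mod4E (leq_maxr (size p) (size q))) -big_split /=.
by apply: eq_bigr => i _; rewrite coefD intrD.
Qed.

Lemma sum_coef_1mod4_0 : sum_coef_1mod4 0 = 0.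
Proof. by rewrite /sum_coef_1mod4 size_poly0 big_ord0. Qed.

Lemma sum_coef_1mod4Z a p : sum_coef_1mod4 (a *: p) = a%:~R * sum_coef_1mod4 p.
Proof.
rewrite (sum_coef_1mod4E (size_scale_leq a p)) mulr_sumr.
by apply: eq_bigr => i _; rewrite coefZ intrM.
Qed.

Lemma sum_coef_1mod4_sum (I : Type) (s : seq I) (P : pred I) (f : I -> {poly int}) :
  sum_coef_1mod4 (\sum_(i <- s | P i) f i) = \sum_(i <- s | P i) sum_coef_1mod4 (f i).
Proof. exact: (big_morph _ sum_coef_1mod4D sum_coef_1mod4_0). Qed.

Lemma sum_coef_1mod4Xn m : sum_coef_1mod4 'X^m = ((m %% 4 == 1)%N)%:R.
Proof.
rewrite /sum_coef_1mod4 size_polyXn big_mkcond big_ord_recr /= big1 ?add0r.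
  by rewrite coefXn eqxx; case: ifP.
by move=> i _; rewrite coefXn (ltn_eqF (ltn_ord i)) if_same.
Qed.

(** Exponents i and i + m agree mod 4, so both or neither are counted. *)
Lemma sum_coef_1mod4_mulXn m q :
  (4 %| m)%N -> sum_coef_1mod4 (q * ('X^m + 1)) = 0.
Proof.
move=> m4; rewrite -[q in q * _]coefK poly_def mulr_suml sum_coef_1mod4_sum big1 // => i _.
rewrite -scalerAl sum_coef_1mod4Z mulrDr mulr1 -exprD sum_coef_1mod4D !sum_coef_1mod4Xn.
rewrite -(modnDmr i) (eqP m4) addn0.
by case: eqP => _; rewrite ?addr0 ?mulr0 //; apply/eqP; rewrite mulf_eq0 orbT.
Qed.

Lemma parity_of_relation (F : numFieldType) (r : nat) (x : F)
    (p : nat) (f g : 'I_p -> nat) (M : int) :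
  x ^+ (2 ^ r) = -1 -> (2 <= r)%N ->
  (forall k, f k <= 2 ^ r.+1)%N -> (forall k, g k <= 2 ^ r.+1)%N ->
  \sum_k (x ^+ f k + x ^+ (2 ^ r.+1 - f k)) =
    \sum_k (x ^+ g k + x ^+ (2 ^ r.+1 - g k)) + M%:~R ->
  odd (\sum_k f k) = odd (\sum_k g k).
Proof.
move=> xr r2 fn gn fg.
pose Q (f : 'I_p -> nat) : {poly int} := \sum_k ('X^(f k) + 'X^(2 ^ r.+1 - f k)).
have QE f0 : (map_poly intr (Q f0)).[x] = \sum_k (x ^+ f0 k + x ^+ (2 ^ r.+1 - f0 k)).
  rewrite rmorph_sum horner_sum; apply: eq_bigr => k _.
  by rewrite rmorphD /= !map_polyXn !hornerE.
have d4 : (4 %| 2 ^ r)%N by rewrite (dvdn_exp2l 2 r2).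
have [|q qE] := @dvdp_int_poly_root_pow2 F r x xr (Q f - Q g - M%:P).
  rewrite /root !rmorphB /= map_polyC !hornerE !QE fg.
  by apply/eqP; ring.
have two0 : 2%:R = 0 :> 'F_2 by apply/eqP.
have odd2 m : m%:R = (odd m)%:R :> 'F_2.
  by rewrite -[m in LHS]odd_double_half natrD -muln2 natrM two0 mulr0 addr0.
have LQ (f0 : 'I_p -> nat) : (forall k, f0 k <= 2 ^ r.+1)%N ->
    sum_coef_1mod4 (Q f0) = (odd (\sum_k f0 k))%:R.
  move=> f0n; rewrite -odd2 natr_sum sum_coef_1mod4_sum; apply: eq_bigr => k _.
  rewrite sum_coef_1mod4D !sum_coef_1mod4Xn -natrD [LHS]odd2 [RHS]odd2; congr (nat_of_bool _)%:R.
  move: d4 (f0n k); rewrite expnS => /dvdnP[a ->] le; lia.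
have N2 s : sum_coef_1mod4 (- s) = sum_coef_1mod4 s.
  by rewrite -scaleN1r sum_coef_1mod4Z rmorphN1 mulN1r; case: (sum_coef_1mod4 s) => -[|[]] // ?; apply/eqP.
(* The integer [M] sits at exponent 0, which is not counted. *)
have LM : sum_coef_1mod4 M%:P = 0.
  by rewrite -[M%:P]mulr1 mul_polyC -(expr0 'X) sum_coef_1mod4Z sum_coef_1mod4Xn mulr0.
have := congr1 sum_coef_1mod4 qE; rewrite sum_coef_1mod4_mulXn // !sum_coef_1mod4D !N2 LM !LQ // addr0.
by do 2 case: odd => //; move/eqP.
Qed.

(** * Circulant matrices and their exponential *)

Section Cis.
Variable R : realType.
Local Notation C := R[i].

Definition cis (x : R) : C := cos x +i* sin x.

Lemma cis0 : cis 0 = 1.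
Proof. by rewrite /cis cos0 sin0. Qed.

Lemma cisD x y : cis (x + y) = cis x * cis y.
Proof. by rewrite /cis cosD sinD; simpc; congr (_ +i* _); rewrite addrC. Qed.

Lemma cisN x : cis (- x) = (cis x)^*.
Proof. by rewrite /cis cosN sinN. Qed.

Lemma norm_cis x : `|cis x| = 1.
Proof. by rewrite normc_def cos2Dsin2 sqrtr1. Qed.

Lemma cisMn x m : cis (x *+ m) = cis x ^+ m.
Proof.
by elim: m => [|m IH]; rewrite ?mulr0n ?cis0 // mulrS cisD IH exprS.
Qed.

Lemma cis_sum (I : Type) (s : seq I) (P : pred I) (f : I -> R) :
  cis (\sum_(i <- s | P i) f i) = \prod_(i <- s | P i) cis (f i).
Proof. exact: (big_morph _ cisD cis0). Qed.

Lemma cis_pi : cis pi = -1.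
Proof. by rewrite /cis cospi sinpi; apply/eqP; rewrite eq_complex /= oppr0 !eqxx. Qed.

Lemma cis_2piz (z : int) : cis (2 * pi * z%:~R) = 1.
Proof.
have c1 : cis (2 * pi) = 1 by rewrite mulr_natl cisMn cis_pi sqrrN expr1n.
case: z => m; first by rewrite mulr_natr cisMn c1 expr1n.
by rewrite NegzE rmorphN mulrN cisN mulr_natr cisMn c1 expr1n rmorph1.
Qed.

(** After reduction to [[0, 2 pi)], injectivity of cosine settles [[0, pi]], and sine does not
    vanish beyond [pi]. *)
Lemma cis_eq1 x : cis x = 1 -> exists z : int, x = 2 * pi * z%:~R.
Proof.
move=> cx; have p0 := pi_gt0 R; have p20 : 0 < 2 * pi :> R by rewrite mulr_gt0.
pose z := Num.floor (x / (2 * pi)); exists z.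
pose y := x - 2 * pi * z%:~R.
have cy : cis y = 1.
  by rewrite cisD cx mul1r cisN cis_2piz rmorph1.
suff : y = 0 by move/eqP; rewrite subr_eq0 => /eqP.
have /andP[y0 y1] : 0 <= y < 2 * pi.
  have /andP[] := floor_itv (x / (2 * pi)).
  rewrite -/z ler_pdivlMr // ltr_pdivrMr // intrD => a b.
  by rewrite /y; apply/andP; split; lra.
have cosy : cos y = 1 by case: cy.
have siny : sin y = 0 by case: cy.
have [yp|yp] := leP y pi.
  have := @cos_inj R y 0; rewrite !in_itv /= cos0 lexx y0 yp ltW //; exact.
have : 0 < sin (y - pi) by apply: sin_gt0_pi; apply/andP; split; lra.
by rewrite sinB siny cospi sinpi mulr0 mul0r subrr ltxx.
Qed.

Lemma exp_coeff_cis (s : R) (p : nat) :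
  (p`!%:R)^-1 * ('i * s%:C) ^+ p = cos_coeff s p +i* sin_coeff s p.
Proof.
have -> : (p`!%:R)^-1 * ('i * s%:C) ^+ p = 'i ^+ p * (s ^+ p / p`!%:R)%:C.
  by rewrite exprMn rmorphM fmorphV rmorph_nat rmorphXn /= mulrC mulrA.
have -> : 'i ^+ p = (if odd p then 'i else 1) * ((-1) ^+ p./2)%:C :> C.
  rewrite -[p in LHS]odd_double_half exprD -mul2n exprM sqr_i rmorphXn rmorphN1.
  by case: odd.
rewrite /cos_coeff /sin_coeff /= -!mulrA; case: ifP => po.
  have -> : p.-1./2 = p./2 by rewrite -(odd_double_half p) po /= doubleK uphalf_double.
  by simpc.
by rewrite mul1r -rmorphM mul0r mul1r.
Qed.

(** Radii in the topology of [R[i]] are complex; positivity makes them real. *)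
Lemma complex_gt0E (e : C) : 0 < e -> e = (complex.Re e)%:C /\ 0 < complex.Re e.
Proof. by case: e => x y; rewrite ltcE /= => /andP[/eqP -> ->]. Qed.

Lemma cvg_complex (u v : nat -> R) (a b : R) :
  u @ \oo --> a -> v @ \oo --> b -> (fun p => u p +i* v p) @ \oo --> a +i* b.
Proof.
move=> /cvgrPdist_lt ua /cvgrPdist_lt vb; apply/cvgrPdist_lt => e e0.
have [er ep] := complex_gt0E e0.
have e2 : 0 < complex.Re e / 2 by rewrite divr_gt0.
near=> p; rewrite er.
have -> : a +i* b - (u p +i* v p) = (a - u p)%:C + 'i * (b - v p)%:C by simpc.
apply: le_lt_trans (ler_normD _ _) _; rewrite normrM normCi mul1r !normc_def /=.
rewrite !expr0n !addr0 !sqrtr_sqr -rmorphD ltcR [ltRHS]splitr.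
apply: ltrD; near: p; [exact: ua | exact: vb].
Unshelve. all: by end_near. Qed.

Lemma exp_series_cis (s : R) :
  series (fun j : nat => (j`!%:R)^-1 * ('i * s%:C) ^+ j) @ \oo --> cis s.
Proof.
rewrite (_ : series _ = fun p => series (cos_coeff s) p +i* series (sin_coeff s) p).
  apply: cvg_complex; rewrite unlock.
    exact: is_cvg_series_cos_coeff.
  exact: is_cvg_series_sin_coeff.
apply/funext; elim=> [|p IH]; first by rewrite /series /= !big_geq.
by rewrite !seriesSr IH exp_coeff_cis.
Qed.
End Cis.

(** * Diagonalisation of circulant matrices by characters *)

Section Spectral.
Variables (C : numClosedFieldType) (m : nat) (zeta : C).
Local Notation N := m.+2.
Hypothesis zN : N.-primitive_root zeta.

(** The character of index [j] is the map sending [x] to [zchar (j * x)], with the product of the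
    ring ['I_N]. *)
Definition zchar (x : 'I_N) : C := zeta ^+ x.
Local Notation chi := zchar.

Lemma zchar0 : chi 0 = 1. Proof. by []. Qed.

Lemma zcharD x y : chi (x + y) = chi x * chi y.
Proof. by rewrite /zchar -exprD -[RHS](expr_mod _ (prim_expr_order zN)). Qed.

Lemma zcharN x : chi (- x) = (chi x)^-1.
Proof.
have H : chi (- x) * chi x = 1 by rewrite -zcharD addNr zchar0.
by rewrite -[LHS]mulr1 -[X in _ * X](divff (x := chi x)) ?mulrA ?H ?mul1r //;
  apply: contraTneq (oner_neq0 C) => c0; rewrite -H c0 mulr0 eqxx.
Qed.

Lemma norm_zchar x : `|chi x| = 1.
Proof.
apply/eqP; rewrite -(@pexpr_eq1 _ _ N) // -normrX -exprM mulnC exprM.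
by rewrite (prim_expr_order zN) expr1n normr1.
Qed.

(** Translating [j] by 1 multiplies the sum by [chi x], which is not 1 unless [x = 0]. *)
Lemma sum_zchar x : \sum_j chi (j * x) = N%:R *+ (x == 0).
Proof.
have [->|x0] := eqVneq x 0.
  by under eq_bigr do rewrite mulr0 zchar0; rewrite sumr_const card_ord.
have cx : chi x != 1.
  by rewrite -(expr0 zeta) /zchar (eq_prim_root_expr zN) mod0n modn_small.
apply/eqP; rewrite mulr0n -[_ == 0](orFb) -(negbTE cx) -subr_eq0 -mulf_eq0.
rewrite mulrBl mul1r subr_eq0; apply/eqP.
rewrite mulr_sumr [RHS](reindex_inj (addIr 1)) /=.
by apply: eq_bigr => j _; rewrite mulrDl mul1r zcharD mulrC.
Qed.

(* The circulant matrix with eigenvalue [F j] on the character [j]. *)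
Definition spec_mx (F : 'I_N -> C) : 'M[C]_N :=
  \matrix_(a, b) (N%:R^-1 * \sum_j F j * chi (j * (b - a))).

Lemma N_neq0 : N%:R != 0 :> C. Proof. by rewrite pnatr_eq0. Qed.

Lemma eq_spec_mx F G : F =1 G -> spec_mx F = spec_mx G.
Proof.
by move=> FG; apply/matrixP => a b; rewrite !mxE; under eq_bigr do rewrite FG.
Qed.

Lemma spec_mx1 : spec_mx (fun=> 1) = 1%:M.
Proof.
apply/matrixP => a b; rewrite !mxE; under eq_bigr do rewrite mul1r.
by rewrite sum_zchar subr_eq0 eq_sym mulrnAr mulVf ?N_neq0.
Qed.

Lemma spec_mxZ a F : a *: spec_mx F = spec_mx (fun j => a * F j).
Proof.
apply/matrixP => x y; rewrite !mxE mulrCA; congr (_ * _).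
by rewrite mulr_sumr; apply: eq_bigr => j _; rewrite mulrA.
Qed.

Lemma spec_mxD F G : spec_mx F + spec_mx G = spec_mx (fun j => F j + G j).
Proof.
apply/matrixP => x y; rewrite !mxE -mulrDr; congr (_ * _).
by rewrite -big_split; apply: eq_bigr => j _; rewrite mulrDl.
Qed.

Lemma spec_mx0 : spec_mx (fun=> 0) = 0.
Proof.
apply/matrixP => x y; rewrite !mxE big1 ?mulr0 // => j _; exact: mul0r.
Qed.

Lemma spec_mx_sum (I : Type) (s : seq I) (F : I -> 'I_N -> C) :
  \sum_(i <- s) spec_mx (F i) = spec_mx (fun j => \sum_(i <- s) F i j).
Proof.
elim: s => [|i s IH].
  by rewrite big_nil -spec_mx0; apply: eq_spec_mx => j; rewrite big_nil.
by rewrite big_cons IH spec_mxD; apply: eq_spec_mx => j; rewrite big_cons.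
Qed.

Lemma spec_mxM F G : spec_mx F *m spec_mx G = spec_mx (fun j => F j * G j).
Proof.
apply/matrixP => a b; rewrite !mxE.
transitivity (N%:R^-1 * N%:R^-1 * \sum_j \sum_l F j * G l *
    (chi (- (j * a)) * chi (l * b) * \sum_x chi (x * (j - l)))).
  under eq_bigr do rewrite !mxE mulrACA big_distrlr /=.
  rewrite -mulr_sumr; congr (_ * _); rewrite exchange_big /=.
  apply: eq_bigr => j _; rewrite exchange_big /=; apply: eq_bigr => l _.
  rewrite !mulr_sumr; apply: eq_bigr => x _; rewrite mulrACA; congr (_ * _).
  by rewrite -!zcharD; congr chi; ring.
rewrite -mulrA; congr (_ * _); rewrite mulr_sumr; apply: eq_bigr => j _.
rewrite (bigD1 j) //= [X in _ + X]big1 ?addr0 => [|l lj].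
  rewrite sum_zchar subrr eqxx mulr1n mulrA mulrCA [X in _ * X]mulrC -zcharD.
  rewrite [in LHS]mulrA -[RHS]mulr1 -[X in _ = _ * X](mulVf N_neq0).
  by rewrite mulrBr [_ - _]addrC; ring.
by rewrite sum_zchar subr_eq0 eq_sym (negbTE lj) mulr0n !mulr0.
Qed.

Lemma spec_mxX F p : spec_mx F ^+ p = spec_mx (fun j => F j ^+ p).
Proof.
elim: p => [|p IH]; first by rewrite expr0 -[1]spec_mx1; apply: eq_spec_mx.
rewrite exprS IH -[_ * _]/(_ *m _) spec_mxM.
by apply: eq_spec_mx => j; rewrite exprS.
Qed.

(** Fourier inversion; the order [b - a] in [spec_mx] is what pairs with [g (a - b)]. *)
Lemma circulant_spec (g : 'I_N -> C) :
  \matrix_(a, b) g (a - b) = spec_mx (fun j => \sum_x g x * chi (j * x)).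
Proof.
apply/matrixP => a b; rewrite !mxE.
transitivity (N%:R^-1 * \sum_x g x * \sum_j chi (j * (x + (b - a)))).
  rewrite (bigD1 (a - b)) //= [X in _ * _ + X]big1 ?addr0 => [|x xab].
    rewrite sum_zchar -opprB addNr eqxx mulr1n.
    by rewrite mulrCA mulVf ?mulr1 ?N_neq0.
  by rewrite sum_zchar -(opprB a b) subr_eq0 (negbTE xab) mulr0n mulr0.
congr (_ * _).
under eq_bigr do rewrite mulr_sumr; rewrite exchange_big /=.
apply: eq_bigr => j _; rewrite mulr_suml; apply: eq_bigr => x _.
by rewrite mulrDr zcharD mulrA.
Qed.

Lemma spec_mx_dist (F G : 'I_N -> C) e a b :
  (forall j, `|F j - G j| < e) -> `|spec_mx F a b - spec_mx G a b| < e.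
Proof.
move=> FG; rewrite !mxE -mulrBr -sumrB normrM normfV normr_nat.
rewrite mulrC ltr_pdivrMr ?ltr0n //; apply: le_lt_trans (ler_norm_sum _ _ _) _.
apply: (@lt_le_trans _ _ (\sum_(j < N) e)).
  apply: ltr_sum => [|j _]; first by apply/hasP; exists 0; rewrite ?mem_index_enum.
  by rewrite -mulrBl normrM norm_zchar mulr1.
by rewrite sumr_const card_ord mulr_natr.
Qed.

End Spectral.

(** * Transition matrices of circulant graphs *)

Section Transfer.
Variables (R : realType) (m : nat) (zeta : R[i]).
Local Notation N := m.+2.
Hypothesis zN : N.-primitive_root zeta.
Local Notation spec_mx := (spec_mx zeta).
Local Notation chi := (zchar zeta).

Lemma cvg_spec_mx (F : nat -> 'I_N -> R[i]) (G : 'I_N -> R[i]) :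
  (forall j, (fun p => F p j) @ \oo --> G j) ->
  (fun p => spec_mx (F p)) @ \oo --> spec_mx G.
Proof.
move=> FG; apply/cvg_ballP => e e0.
have : \forall p \near \oo, forall j, `|G j - F p j| < e.
  apply: filter_forall => j; have /cvgrPdist_lt := FG j; exact.
apply: filterS => p H; split => // a b; rewrite -ball_normE /=.
exact: spec_mx_dist.
Qed.

(** Partial sums of the exponential series act eigenvalue by eigenvalue, and finitely many
    eigenvalues converge together. *)
Lemma transition_mx_spec (G : sgraph N) (l : 'I_N -> R) (t : R) :
  adjmx R G = spec_mx (fun j => (l j)%:C) ->
  transition_mx G t = spec_mx (fun j => cis (- (t * l j))).
Proof.
move=> GE; apply: cvg_lim; first exact: norm_hausdorff.
have -> : series (fun j : nat => (j`!%:R)^-1 *: (- ('i * t%:C) *: adjmx R G) ^+ j) =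
  fun p => spec_mx (fun j => series (fun i : nat => (i`!%:R)^-1 * ('i * (- (t * l j))%:C) ^+ i) p).
  apply/funext => p; rewrite GE spec_mxZ /series /= -spec_mx_sum.
  apply: eq_bigr => i _; rewrite spec_mxX // spec_mxZ; apply: eq_spec_mx => j.
  by congr (_ * _ ^+ _); rewrite rmorphN rmorphM mulrN mulrA mulNr.
by apply: cvg_spec_mx => j; apply: exp_series_cis.
Qed.

Lemma cvg_col (T : pseudoMetricNormedZmodType R[i]) (p q : nat) (j : 'I_q)
    (X : nat -> 'M[T]_(p, q)) (Y : 'M[T]_(p, q)) :
  X @ \oo --> Y -> (fun s => col j (X s)) @ \oo --> col j Y.
Proof.
move=> /cvg_ballP XY; apply/cvg_ballP => e e0.
apply: filterS (XY e e0) => s [_ H]; split => // a b; rewrite !mxE; exact: H.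
Qed.

(** The matrix with eigenvalues [chi (j * h)] has [basis_vec R h] as column 0, so the transfer runs
    from 0 to [h] with phase 1. *)
Lemma pgst_circulant (G : sgraph N) (l : 'I_N -> R) (t : nat -> R) (h : 'I_N) :
  adjmx R G = spec_mx (fun j => (l j)%:C) -> h != 0 ->
  (forall j, (fun p => cis (- (t p * l j))) @ \oo --> chi (j * h)) ->
  pretty_good_state_transfer G t.
Proof.
move=> GE h0 tP; exists 0, h; rewrite eq_sym; split=> //.
exists 1; split; first exact: normr1.
rewrite scale1r.
have -> : basis_vec R h = col 0 (spec_mx (fun j => chi (j * h))).
  apply/matrixP => a b; rewrite !mxE ord1 eqxx andbT.
  under eq_bigr do rewrite -zcharD // -mulrDr addrA addr0.
  by rewrite sum_zchar // subr_eq0 mulrnAr mulVf ?pnatr_eq0 // eq_sym.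
rewrite (_ : (fun p => _) =
    fun p => col 0 (spec_mx (fun j => cis (- (t p * l j))))); last first.
  by apply/funext => p; rewrite /basis_vec -colE (transition_mx_spec _ GE).
exact/cvg_col/cvg_spec_mx.
Qed.

End Transfer.

(** * Sums over gcd classes *)

(** Below [k], the gcd class fixes the 2-adic valuation of [x] to be exactly [e]. *)
Lemma gcdn_pow2_eq (x k e : nat) : (e < k)%N ->
  (gcdn x (2 ^ k) == 2 ^ e)%N = (2 ^ e %| x)%N && ~~ (2 ^ e.+1 %| x)%N.
Proof.
move=> ek; apply/eqP/andP => [E|[d1 d2]].
  split; first by rewrite -E dvdn_gcdl.
  apply/negP => d; have : (2 ^ e.+1 %| gcdn x (2 ^ k))%N.
    by rewrite dvdn_gcd d dvdn_exp2l.
  by rewrite E dvdn_Pexp2l // ltnn.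
have /(dvdn_pfactor _ _ (isT : prime 2)) [f fk E] := dvdn_gcdr x (2 ^ k).
rewrite E; congr (2 ^ _)%N; apply/eqP; rewrite eqn_leq; apply/andP; split.
  rewrite leqNgt; apply: contra d2 => ef.
  by apply: dvdn_trans (dvdn_gcdl x (2 ^ k)); rewrite E dvdn_exp2l.
by rewrite -(@dvdn_Pexp2l 2) // -E dvdn_gcd d1 dvdn_exp2l // ltnW.
Qed.

Section IntegerSums.
Variables (C : numClosedFieldType) (m k : nat) (zeta : C).
Local Notation N := m.+2.
Hypothesis zN : N.-primitive_root zeta.
Hypothesis Nk : N = (2 ^ k)%N.
Local Notation chi := (zchar zeta).

Lemma sum_is_int (I : Type) (s : seq I) (P : pred I) (F : I -> C) :
  (forall i, P i -> exists z : int, F i = z%:~R) ->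
  exists z : int, \sum_(i <- s | P i) F i = z%:~R.
Proof.
move=> FP; apply: (big_ind (fun y : C => exists z : int, y = z%:~R)) => //.
- by exists 0.
- by move=> _ _ [a ->] [b ->]; exists (a + b); rewrite intrD.
Qed.

(* The class is invariant under translation by [2^(e+1)], so the sum vanishes
   unless the character is trivial on it, and then takes only the values [1] or
   [-1] on the class. *)
Lemma ramanujan_sum_int (e : nat) (j : 'I_N) : (e < k)%N ->
  exists z : int, \sum_(x : 'I_N | gcdn x N == (2 ^ e)%N) chi (j * x) = z%:~R.
Proof.
move=> ek; set T := \sum_(_ | _) _.
(* When e + 1 = k this is 0, and the character is trivial on it. *)
pose d : 'I_N := inZp (2 ^ e.+1).
have d2 : (2 ^ e.+1 %| N)%N by rewrite Nk dvdn_exp2l.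
have gN y : (gcdn y N == 2 ^ e)%N = (2 ^ e %| y)%N && ~~ (2 ^ e.+1 %| y)%N.
  by rewrite Nk gcdn_pow2_eq.
have shift : T = chi (j * d) * T.
  rewrite /T mulr_sumr (reindex_inj (addIr d)) /=.
  apply: eq_big => x; last by rewrite mulrDr zcharD // mulrC.
  have dmod a y : (2 ^ a %| N)%N -> (2 ^ a %| y %% N)%N = (2 ^ a %| y)%N.
    by move=> aN; rewrite [in RHS](divn_eq y N) dvdn_addr // dvdn_mull.
  have d1 : (2 ^ e %| N)%N by rewrite (dvdn_trans _ d2) // dvdn_exp2l.
  rewrite !gN /= modnDmr !dmod //.
  by rewrite !dvdn_addl // dvdn_exp2l.
have [c1|c1] := eqVneq (chi (j * d)) 1; last first.
  exists 0; apply/eqP; rewrite -[T == 0]orFb -(negbTE c1) -(subr_eq0 _ 1) -mulf_eq0.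
  by rewrite mulrBl mul1r -shift subrr.
apply: sum_is_int => x; rewrite gN => /andP[/dvdnP[u xu] nx].
have chid : chi (j * x) = chi (j * inZp (2 ^ e)) ^+ u.
  have E (a b : 'I_N) : chi (a * b) = zeta ^+ (a * b)%N.
    by rewrite /zchar /= (expr_mod _ (prim_expr_order zN)).
  rewrite !E -exprM xu [(u * _)%N]mulnC mulnA [LHS]exprM [RHS]exprM; congr (_ ^+ _).
  rewrite -[LHS](expr_mod _ (prim_expr_order zN)).
  by rewrite -[RHS](expr_mod _ (prim_expr_order zN)) /= modnMmr.
(* Twice the residue of [2 ^ e] is [d]. *)
have c2 : chi (j * inZp (2 ^ e)) ^+ 2 = 1.
  rewrite expr2 -zcharD // -mulrDr -c1; congr (zchar _ (_ * _)); apply/val_inj => /=.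
  by rewrite modnDm addnn expnS mul2n.
move: c2 => /eqP; rewrite sqrf_eq1 chid => /orP[] /eqP ->.
  by exists 1; rewrite expr1n.
by exists ((-1) ^+ u); rewrite rmorphXn rmorphN1.
Qed.

Lemma gcd_sum_int (n : nat) (D : {fset nat}) (j : 'I_N) :
  n = N -> proper_divisors n D ->
  exists z : int, \sum_(x : 'I_N) (gcdn x n \in D)%:R * chi (j * x) = z%:~R.
Proof.
move=> -> hD; under eq_bigr do rewrite mulr_natl mulrb.
(* The sum is split by gcd value; gcds are at most [N], so [inord] into ['I_N.+1] alters none. *)
rewrite -big_mkcond (partition_big (fun x : 'I_N => inord (gcdn x N) : 'I_N.+1) xpredT) //=.
apply: sum_is_int => d _.
have [dD|dD] := boolP (val d \in D); last first.
  exists 0; apply: big_pred0 => x; apply/negP => /andP[xD /eqP xd].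
  by move: dD; rewrite -xd /= inordK ?xD // ltnS dvdn_leq // dvdn_gcdr.
have [dn dlt] := hD _ dD.
have /(dvdn_pfactor _ _ (isT : prime 2)) [e ek E] : (d %| 2 ^ k)%N by rewrite -Nk.
have [|z zP] := @ramanujan_sum_int e j.
  by rewrite -(@ltn_exp2l 2) // -E -Nk.
exists z; rewrite -zP; apply: eq_bigl => x; rewrite -E.
have xN : (gcdn x N < N.+1)%N by rewrite ltnS dvdn_leq // dvdn_gcdr.
apply/andP/eqP => [[xD /eqP <-]|xd]; first by rewrite inordK.
by rewrite xd dD; split=> //; apply/eqP/val_inj; rewrite /= inordK // -xd.
Qed.
End IntegerSums.

(** * State transfer *)

Section CycleTransfer.
Variables (R : realType) (m r : nat).
Local Notation N := m.+2.
Hypothesis r2 : (2 <= r)%N.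
Hypothesis Nr : N = (2 ^ r.+1)%N.

Definition cycle_angle : R := 2 * pi / N%:R.
Local Notation zeta := (cis cycle_angle).
Local Notation chi := (zchar zeta).

Definition cycle_eig (j : 'I_N) : R := 2 * cos (cycle_angle *+ j).

Lemma zeta_half : zeta ^+ (2 ^ r) = -1.
Proof.
rewrite -cisMn -cis_pi /cycle_angle Nr expnS natrM -mulr_natr; congr cis.
by field; rewrite pnatr_eq0 expn_eq0.
Qed.

Lemma zeta_prim : N.-primitive_root zeta.
Proof. by rewrite Nr; apply/primitive_root_pow2/zeta_half. Qed.

Lemma zchar_cycle_eig (j : 'I_N) : chi j + chi (- j) = (cycle_eig j)%:C.
Proof.
have zP := zeta_prim; rewrite (zcharN zP) norm1_invE ?(norm_zchar zP) //.
by rewrite /zchar -cisMn /cis /cycle_eig; simpc; congr (_ +i* _); ring.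
Qed.

(** The form used by [parity_of_relation]: at [j = 0] the second exponent is [N] rather than 0, with
    the same power. *)
Lemma root_cycle_eig (j : 'I_N) :
  zeta ^+ j + zeta ^+ (2 ^ r.+1 - j) = (cycle_eig j)%:C.
Proof.
rewrite -Nr -zchar_cycle_eig; congr (_ + _).
by rewrite /zchar /= (expr_mod _ (prim_expr_order zeta_prim)).
Qed.

Definition half_turn : 'I_N := inZp (2 ^ r).

Lemma zchar_half (j : 'I_N) : chi (j * half_turn) = (-1) ^+ j.
Proof.
rewrite /zchar /= modnMmr (expr_mod _ (prim_expr_order zeta_prim)) mulnC exprM.
by rewrite zeta_half.
Qed.

Lemma half_turn_neq0 : half_turn != 0.
Proof.
by rewrite -val_eqE /= Nr modn_small ?ltn_exp2l // -lt0n expn_gt0.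
Qed.

(** Equal products make the two eigenvalue sums differ by an integer, and [parity_of_relation] then
    equates the signs. *)
Lemma cycle_relation (p : nat) (f g : {ffun 'I_p -> 'I_N}) :
  \prod_k cis (- (2 * pi * cycle_eig (f k))) =
    \prod_k cis (- (2 * pi * cycle_eig (g k))) ->
  \prod_k chi (f k * half_turn) = \prod_k chi (g k * half_turn).
Proof.
move=> fg; under eq_bigr do rewrite zchar_half.
under [RHS]eq_bigr do rewrite zchar_half.
rewrite -!expr_sum -[LHS]signr_odd -[RHS]signr_odd; congr (_ ^+ nat_of_bool _).
have [z zP] : exists z : int,
    \sum_k cycle_eig (g k) - \sum_k cycle_eig (f k) = z%:~R.
  have [|z zP] := @cis_eq1 R (2 * pi * (\sum_k cycle_eig (g k) - \sum_k cycle_eig (f k))).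
    have cE (u : {ffun 'I_p -> 'I_N}) :
        \prod_k cis (- (2 * pi * cycle_eig (u k))) = cis (- (2 * pi * \sum_k cycle_eig (u k))).
      by rewrite -cis_sum sumrN mulr_sumr.
    by rewrite mulrBr cisD -cE fg cE -cisD subrr cis0.
  by exists z; apply: mulfI zP; apply/lt0r_neq0; rewrite mulr_gt0 // pi_gt0.
symmetry; apply: (parity_of_relation zeta_half (M := z)) => //.
- by move=> k; rewrite -Nr ltnW.
- by move=> k; rewrite -Nr ltnW.
under eq_bigr do rewrite root_cycle_eig.
under [in RHS]eq_bigr do rewrite root_cycle_eig.
rewrite -!rmorph_sum /= -(rmorph_int (@real_complex R)) -zP -rmorphD /=.
by congr _%:C; ring.
Qed.

Lemma cycle_approx : exists t : nat -> nat, forall p j,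
  `|cis (- (2 * pi * cycle_eig j)) ^+ t p - chi (j * half_turn)| < (p.+1%:R^-1)%:C.
Proof.
suff /boolp.choice[t tP] : forall p, exists t : nat, forall j,
    `|cis (- (2 * pi * cycle_eig j)) ^+ t - chi (j * half_turn)| < (p.+1%:R^-1)%:C.
  by exists t.
move=> p; apply: (kronecker_approx (i0 := 0)).
- by move=> j; rewrite norm_cis.
- by move=> j; rewrite norm_zchar //; apply: zeta_prim.
- exact: cycle_relation.
- rewrite /cycle_eig mulr0n cos0 mulr1 cisN.
  by have := @cis_2piz R 2; rewrite mulrz_nat => ->; rewrite rmorph1.
- by rewrite mul0r zchar0.
- by rewrite invr_gt0.
Qed.

Lemma cvg_of_inv_bound (u : nat -> R[i]) (c : R[i]) :
  (forall p, `|u p - c| < (p.+1%:R^-1)%:C) -> u @ \oo --> c.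
Proof.
move=> uc; apply/cvgrPdist_lt => e e0.
have [er ep] := complex_gt0E e0.
near=> p; rewrite distrC; apply: lt_trans (uc p) _; rewrite er ltcR.
near: p; exact: (near_infty_natSinv_lt (PosNum ep)).
Unshelve. all: by end_near. Qed.

(** The integers [M j] only add multiples of [2 pi]; for [s = true] the phases are conjugated, which
    preserves distances to the real targets [(-1) ^+ j]. *)
Lemma cycle_like_pgst (s : bool) (G : sgraph N) (t : nat -> nat)
    (M : 'I_N -> int) :
  (forall p j, `|cis (- (2 * pi * cycle_eig j)) ^+ t p - chi (j * half_turn)|
     < (p.+1%:R^-1)%:C) ->
  adjmx R G = spec_mx zeta (fun j => ((-1) ^+ s * cycle_eig j + (M j)%:~R)%:C) ->
  pretty_good_state_transfer G (fun p => 2 * pi * (t p)%:~R : R).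
Proof.
move=> tP GE; apply: (pgst_circulant zeta_prim GE half_turn_neq0) => j.
apply: cvg_of_inv_bound => p.
have -> : cis (- (2 * pi * (t p)%:~R * ((-1) ^+ s * cycle_eig j + (M j)%:~R))) =
    cis ((-1) ^+ s * - (2 * pi * cycle_eig j) *+ t p).
  rewrite -mulr_natr -[RHS]mulr1 -(cis_2piz R (- ((t p)%:Z * M j))) -cisD.
  by congr cis; rewrite rmorphN rmorphM /=; ring.
rewrite cisMn; case: s {GE}; last by rewrite expr0 mul1r.
rewrite expr1 mulN1r cisN zchar_half -rmorphXn /= -(rmorph_sign (@Num.conj R[i])) -rmorphB.
by rewrite norm_conjC -zchar_half.
Qed.

End CycleTransfer.

Theorem theorem2p3 (R : realType) (n k : nat) (D : {fset nat})
    (hk : (3 <= k)%N) (hn : n = (2 ^ k)%N)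
    (hD : proper_divisors n D) (h1 : 1%N \notin D) :
  let G := union_graph (cycle_graph n) (gcd_graph hD) in
  exists t : nat -> R,
    (forall m : nat, exists z : int, t m = 2 * pi * z%:~R) /\
    pretty_good_state_transfer G t /\
    pretty_good_state_transfer (compl_graph G) t.
Proof.
move=> G; have [r kr r2] : exists2 r, k = r.+1 & (2 <= r)%N.
  by case: k hk {hn} => // r; exists r.
have n1 : (1 < n)%N by rewrite hn kr -(expn0 2) ltn_exp2l.
have n2 : (2 < n)%N by rewrite hn (@ltn_trans (2 ^ 2)) // ltn_exp2l.
have Nn := Zp_cast n1.
have Nr : (Zp_trunc n).+2 = (2 ^ r.+1)%N by rewrite Nn hn kr.
pose zeta : R[i] := cis (cycle_angle R (Zp_trunc n)).
have zN : (Zp_trunc n).+2.-primitive_root zeta := zeta_prim R Nr.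
have /boolp.choice[M MP] : forall j : 'Z_n, exists z : int,
    \sum_(x : 'Z_n) (gcdn x n \in D)%:R * zchar zeta (j * x) = z%:~R.
  by move=> j; apply: (gcd_sum_int zN Nr).
have chi_lin (j y : 'Z_n) : \sum_(x : 'Z_n) (x == y)%:R * zchar zeta (j * x) = zchar zeta (j * y).
  rewrite (bigD1 y) //= eqxx mul1r big1 ?addr0 // => x /negbTE ->; exact: mul0r.
(* The three cases exclude each other: 1 and -1 are distinct as n > 2, and both have gcd 1 with [n],
   while 1 is not in [D]. *)
have gE (x : 'Z_n) : [|| x == 1, x == -1 | gcdn x n \in D]%:R =
    (x == 1)%:R + (x == -1)%:R + (gcdn x n \in D)%:R :> R[i].
  have g1 : gcdn (1%R : 'Z_n) n = 1%N by rewrite /= modn_small ?gcd1n // Nn.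
  have gN1 : gcdn ((-1)%R : 'Z_n) n = 1%N.
    rewrite /= !Nn (@modn_small 1) // gcdn_modl subn1 gcdnC.
    by apply/eqP/coprimenP; rewrite ltnW.
  have n11 : (1 : 'Z_n) != -1.
    rewrite -val_eqE /= !Nn (@modn_small 1) // modn_small; lia.
  have [->|x1] := eqVneq x 1.
    by rewrite (negbTE n11) g1 (negbTE h1) !addr0.
  have [->|xN1] := eqVneq x (-1).
    by rewrite gN1 (negbTE h1) add0r addr0.
  by rewrite !add0r.
have lE j : \sum_(x : 'Z_n) [|| x == 1, x == -1 | gcdn x n \in D]%:R * zchar zeta (j * x) =
    (cycle_eig R j + (M j)%:~R)%:C.
  under eq_bigr do rewrite gE !mulrDl; rewrite !big_split /= !chi_lin MP.
  by rewrite mulr1 mulrN1 (zchar_cycle_eig R Nr) rmorphD rmorph_int.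
have [t tP] := cycle_approx R r2 Nr.
exists (fun p => 2 * pi * (t p)%:~R); split; first by move=> p; exists (t p).
have GE a b : G a b = [|| a - b == 1, a - b == -1 | gcdn (a - b)%R n \in D].
  by rewrite /= /union_adj /= /cycle_adj /gcd_adj in_gcd_set orbA.
pose g (x : 'Z_n) : R[i] := [|| x == 1, x == -1 | gcdn x n \in D]%:R.
split.
  apply: (cycle_like_pgst Nr (s := false) (M := M) tP).
  transitivity (spec_mx zeta (fun j => \sum_x g x * zchar zeta (j * x))).
    by rewrite -(circulant_spec zN g); apply/matrixP => a b; rewrite !mxE GE.
  by apply: eq_spec_mx => j; rewrite lE expr0 mul1r.
(* The all-ones matrix contributes N at [j = 0] and 0 elsewhere, the identity -1, and the integer
   part of the graph [- M j]. *)
apply: (cycle_like_pgst Nr (s := true) (M := fun j => ((Zp_trunc n).+2 * (j == 0%R))%N%:Z - 1 - M j) tP).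
transitivity (spec_mx zeta (fun j =>
    \sum_x (1 - (x == 0)%:R - g x) * zchar zeta (j * x))).
  rewrite -(circulant_spec zN (fun x => 1 - (x == 0)%:R - g x)).
  apply/matrixP => a b; rewrite !mxE /g -GE /compl_adj subr_eq0.
  rewrite -[compl_graph G a b]/((a != b) && ~~ G a b).
  have [->|_] := eqVneq a b; first by rewrite adj_irrefl subrr subr0.
  by case: (G a b); rewrite /= !subr0 ?subrr.
apply: eq_spec_mx => j.
under eq_bigr do rewrite !mulrBl; rewrite !sumrB lE chi_lin mulr0 zchar0.
under eq_bigr do rewrite mul1r mulrC; rewrite sum_zchar // -mulrnA.
move: ((Zp_trunc n).+2 * (j == 0%R))%N => q.
by rewrite expr1 mulN1r !intrB -pmulrn !rmorphD !rmorphN /= !rmorph_int rmorph_nat; ring.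
Qed.
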